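(* Let $\Phi\colon\mathbb{R}^n\rightrightarrows\mathbb{R}^m$ be a set-valued mapping with closed graph, let $M:=\{x\in\mathbb{R}^n\mid 0\in\Phi(x)\}$, and let $\bar x\in M$ be AM-regular. Then $$\mathcal{N}_M(\bar x)\subset\mathcal{M}(\bar x,0)=\bigcup_{\lambda\in\mathbb{R}^m}D^*\Phi(\bar x,0)(\lambda).$$
   Context: Normal cones: for a set $A\subset\mathbb{R}^d$ and $\bar a\in A$, the tangent (Bouligand) cone is $\mathcal{T}_A(\bar a):=\{d\mid \exists t_k\searrow 0,\ d_k\to d\colon \bar a+t_kd_k\in A\ \forall k\}$, the regular normal cone is its polar $\widehat{\mathcal{N}}_A(\bar a):=\{v\mid v^\top d\le 0\ \forall d\in\mathcal{T}_A(\bar a)\}$, and the limiting normal cone is $\mathcal{N}_A(\bar a):=\{v\mid\exists a_k\to\bar a,\ a_k\in A,\ v_k\to v,\ v_k\in\widehat{\mathcal{N}}_A(a_k)\ \forall k\}$. All these sets are empty at points outside $A$. Limiting coderivative: with $\operatorname{gph}\Phi:=\{(x,y)\mid y\in\Phi(x)\}$, set $D^*\Phi(x,y)(y^* ):=\{x^*\in\mathbb{R}^n\mid (x^*,-y^* )\in\mathcal{N}_{\operatorname{gph}\Phi}(x,y)\}$ for $y^*\in\mathbb{R}^m$ (empty if $(x,y)\notin\operatorname{gph}\Phi$). AM-regularity: let $\mathcal{M}(x,y):=\bigcup_{\lambda\in\mathbb{R}^m}D^*\Phi(x,y)(\lambda)\subset\mathbb{R}^n$. A point $\bar x\in M$ is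 AM-regular if $\limsup_{x\to\bar x,\,y\to0}\mathcal{M}(x,y)\subset\mathcal{M}(\bar x,0)$, where the left-hand side is the set of all $x^*\in\mathbb{R}^n$ for which there are sequences $x_k\to\bar x$, $y_k\to0$, $x_k^*\to x^*$ with $x_k^*\in\mathcal{M}(x_k,y_k)$ for all $k\in\mathbb{N}$. *)

(* Defs.v *)
From mathcomp Require Import all_boot all_order all_algebra.
From mathcomp Require Import all_classical all_reals all_analysis.

Set Implicit Arguments.
Unset Strict Implicit.
Unset Printing Implicit Defensive.

Import Order.TTheory GRing.Theory Num.Theory.
Import numFieldTopology.Exports numFieldNormedType.Exports.

Local Open Scope classical_set_scope.
Local Open Scope ring_scope.

Section normal_cones.
Variables (R : realType) (d : nat).
Implicit Types (A : set 'rV[R]_d) (a v w : 'rV[R]_d).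

(* All cones are empty at base points outside [A]. *)

(* Bouligand cone; t_k \searrow 0 means t_k > 0 and t_k --> 0, monotonicity
   being available by passing to a subsequence. *)
Definition tangent_cone A a : set 'rV[R]_d :=
  [set w | A a /\
    exists (t : nat -> R) (w_ : nat -> 'rV[R]_d),
      [/\ forall k, 0 < t k,
          t @ \oo --> (0 : R),
          w_ @ \oo --> w
        & forall k, A (a + t k *: w_ k)]].

Definition regular_normal_cone A a : set 'rV[R]_d :=
  [set v | A a /\ forall w, tangent_cone A a w -> (v *m w^T) 0 0 <= 0].

Definition limiting_normal_cone A a : set 'rV[R]_d :=
  [set v | A a /\
    exists a_ v_ : nat -> 'rV[R]_d,
      [/\ a_ @ \oo --> a,
          forall k, A (a_ k),
          v_ @ \oo --> v
        & forall k, regular_normal_cone A (a_ k) (v_ k)]].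

End normal_cones.

Section set_valued_mappings.
Variables (R : realType) (n m : nat).
Variable Phi : 'rV[R]_n -> set 'rV[R]_m.
Implicit Types (x xs : 'rV[R]_n) (y ys : 'rV[R]_m).

(* R^n x R^m is identified with R^(n + m) by concatenation of rows. *)
Definition gph : set 'rV[R]_(n + m) :=
  [set z | Phi (lsubmx z) (rsubmx z)].

Definition coderivative x y ys : set 'rV[R]_n :=
  [set xs | limiting_normal_cone gph (row_mx x y) (row_mx xs (- ys))].

Definition multiplier_image x y : set 'rV[R]_n :=
  \bigcup_(lambda in [set: 'rV[R]_m]) coderivative x y lambda.

Definition multiplier_image_limsup x y : set 'rV[R]_n :=
  [set xs | exists (x_ : nat -> 'rV[R]_n) (y_ : nat -> 'rV[R]_m)
                   (xs_ : nat -> 'rV[R]_n),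
      [/\ x_ @ \oo --> x,
          y_ @ \oo --> y,
          xs_ @ \oo --> xs
        & forall k, multiplier_image (x_ k) (y_ k) (xs_ k)]].

Definition zero_set : set 'rV[R]_n := [set x | Phi x 0].

(* Only meant for points of [zero_set]. *)
Definition AM_regular x : Prop :=
  multiplier_image_limsup x 0 `<=` multiplier_image x 0.

End set_valued_mappings.

(* Main.v *)
(** A regular normal [v] to the zero set at [a] satisfies
    [v . (x - a) <= o(|x - a|)] there.  Penalising the constraint [y = 0], one
    minimises [- v . (x - a) + c |x - a|^2 + k |y|^2] over the part of the graph
    in a small closed ball around [(a, 0)].  For large [k] the minimiser
    [(x, y)] is interior, and minimality of a quadratic makes
    [(v - 2c(x - a), - 2k y)] a regular normal to the graph, so that
    [v - 2c(x - a)] lies in the multiplier image at [(x, y)].  With [c] inversely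
    proportional to the radius, this vector is arbitrarily close to [v]; a
    diagonal argument puts every limiting normal in the limsup that
    AM-regularity controls. *)

Require Import Defs.
From mathcomp Require Import all_boot all_order all_algebra.
From mathcomp Require Import all_classical all_reals all_analysis.
From mathcomp Require Import lra.

Set Implicit Arguments.
Unset Strict Implicit.
Unset Printing Implicit Defensive.

Import Order.TTheory GRing.Theory Num.Theory.
Import numFieldTopology.Exports numFieldNormedType.Exports.

Local Open Scope classical_set_scope.
Local Open Scope ring_scope.

(* [`|u|] is the max norm, so the penalties use the Euclidean square [dot u u]. *)
Section row_vectors.
Variable R : realType.

(** * Euclidean inner product against the max norm *)

Definition dot n (u v : 'rV[R]_n) : R := (u *m v^T) 0 0.

Lemma dotE n (u v : 'rV[R]_n) : dot u v = \sum_i u 0 i * v 0 i.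
Proof. by rewrite /dot mxE; apply: eq_bigr => i _; rewrite mxE. Qed.

Lemma dotC n (u v : 'rV[R]_n) : dot u v = dot v u.
Proof. by rewrite !dotE; apply: eq_bigr => i _; rewrite mulrC. Qed.

Lemma dotDl n (u v w : 'rV[R]_n) : dot (u + v) w = dot u w + dot v w.
Proof. by rewrite /dot mulmxDl mxE. Qed.

Lemma dotDr n (u v w : 'rV[R]_n) : dot u (v + w) = dot u v + dot u w.
Proof. by rewrite dotC dotDl !(dotC u). Qed.

Lemma dotZl n a (u v : 'rV[R]_n) : dot (a *: u) v = a * dot u v.
Proof. by rewrite /dot -scalemxAl mxE. Qed.

Lemma dotZr n a (u v : 'rV[R]_n) : dot u (a *: v) = a * dot u v.
Proof. by rewrite dotC dotZl dotC. Qed.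

Lemma dotNl n (u v : 'rV[R]_n) : dot (- u) v = - dot u v.
Proof. by rewrite -scaleN1r dotZl mulN1r. Qed.

Lemma dot0r n (u : 'rV[R]_n) : dot u 0 = 0.
Proof. by rewrite /dot trmx0 mulmx0 mxE. Qed.

Lemma dot_row_mx n m (u1 v1 : 'rV[R]_n) (u2 v2 : 'rV[R]_m) :
  dot (row_mx u1 u2) (row_mx v1 v2) = dot u1 v1 + dot u2 v2.
Proof. by rewrite /dot tr_row_mx mul_row_col mxE. Qed.

Lemma dotvv_ge0 n (u : 'rV[R]_n) : 0 <= dot u u.
Proof. by rewrite dotE sumr_ge0// => i _; rewrite -expr2 sqr_ge0. Qed.

Lemma norm_coord_le n (u : 'rV[R]_n) i : `|u 0 i| <= `|u|.
Proof.
rewrite [leRHS]/Num.Def.normr/= mx_normrE.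
exact: (le_bigmax _ (fun ij => `|u ij.1 ij.2|) (0, i)).
Qed.

Lemma norm_row_le n (u : 'rV[R]_n) (e : R) :
  0 <= e -> (forall i, `|u 0 i| <= e) -> `|u| <= e.
Proof.
move=> e0 ue; rewrite [leLHS]/Num.Def.normr/= mx_normrE.
by apply: bigmax_le => // -[i j] _; rewrite (ord1 i)/=.
Qed.

(** Each squared coordinate is a term of a nonnegative sum. In this direction the Euclidean penalty
    dominates radii measured in the max norm. *)
Lemma sqr_norm_le_dot n (u : 'rV[R]_n) : `|u| ^+ 2 <= dot u u.
Proof.
rewrite -(sqr_sqrtr (dotvv_ge0 u)) lerXn2r ?nnegrE ?sqrtr_ge0//.
apply: norm_row_le => [|i]; first exact: sqrtr_ge0.
rewrite -sqrtr_sqr ler_wsqrtr// dotE (bigD1 i)//= -expr2 lerDl.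
by rewrite sumr_ge0// => j _; rewrite -expr2 sqr_ge0.
Qed.

Lemma norm_lsubmx_le n m (z : 'rV[R]_(n + m)) : `|lsubmx z| <= `|z|.
Proof. by apply: norm_row_le => // i; rewrite mxE norm_coord_le. Qed.

Lemma norm_rsubmx_le n m (z : 'rV[R]_(n + m)) : `|rsubmx z| <= `|z|.
Proof. by apply: norm_row_le => // i; rewrite mxE norm_coord_le. Qed.

Lemma norm_row_mx0 n m (x : 'rV[R]_n) : `|row_mx x (0 : 'rV[R]_m)| = `|x|.
Proof.
apply/le_anti/andP; split; last first.
  by have := norm_lsubmx_le (row_mx x (0 : 'rV[R]_m)); rewrite row_mxKl.
apply: norm_row_le => // i; rewrite mxE; case: (fintype.split i) => j.
  exact: norm_coord_le.
by rewrite mxE normr0.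
Qed.

Section limits.
Context {T : Type} {F : set_system T} {FF : Filter F}.

Lemma cvg_dot n (f g : T -> 'rV[R]_n) (u v : 'rV[R]_n) :
  f @ F --> u -> g @ F --> v -> (fun t => dot (f t) (g t)) @ F --> dot u v.
Proof.
move=> fu gv.
under eq_fun do rewrite dotE.
rewrite dotE.
apply: (@cvg_big _ _ _ _ _ add_continuous) => i _.
have coord (h : T -> 'rV[R]_n) (w : 'rV[R]_n) :
    h @ F --> w -> (fun t => h t 0 i) @ F --> w 0 i.
  move=> hw; apply: (cvg_comp h (fun M : 'rV[R]_n => M 0 i) hw).
  exact: coord_continuous.
by apply: cvgM; exact: coord.
Qed.

Lemma cvg_lsubmx n m (f : T -> 'rV[R]_(n + m)) (z : 'rV[R]_(n + m)) :
  f @ F --> z -> (fun t => lsubmx (f t)) @ F --> lsubmx z.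
Proof.
move=> /cvgrPdist_le fz; apply/cvgrPdist_le => e /fz.
by apply: filterS => t; apply: le_trans; rewrite -linearB norm_lsubmx_le.
Qed.

Lemma cvg_rsubmx n m (f : T -> 'rV[R]_(n + m)) (z : 'rV[R]_(n + m)) :
  f @ F --> z -> (fun t => rsubmx (f t)) @ F --> rsubmx z.
Proof.
move=> /cvgrPdist_le fz; apply/cvgrPdist_le => e /fz.
by apply: filterS => t; apply: le_trans; rewrite -linearB norm_rsubmx_le.
Qed.

End limits.

(** * Convergence and compactness of sequences *)

Lemma cvg0_le_harmonic (V : normedModType R) (t : nat -> V) :
  (forall k, `|t k| <= k.+1%:R^-1) -> t @ \oo --> (0 : V).
Proof.
move=> th; apply/cvgr0Pnorm_le => e e0.
have /cvgr0Pnorm_le/(_ e e0) := @cvg_harmonic R.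
apply: filterS => k; apply: le_trans; rewrite (le_trans (th k))//.
exact: ler_norm.
Qed.

Lemma cvg_dist_harmonic n (u v : nat -> 'rV[R]_n) (l : 'rV[R]_n) :
  u @ \oo --> l -> (forall k, `|v k - u k| <= k.+1%:R^-1) -> v @ \oo --> l.
Proof.
move=> ul vu; rewrite -[l]addr0.
have -> : v = u \+ (v \- u) by apply/funext => k /=; rewrite addrC subrK.
by apply: cvgD => //; exact: cvg0_le_harmonic.
Qed.

(** Indices [s k] are picked beyond [k] within [1 / (k + 1)] of a cluster point. They need not
    increase: [k <= s k] already sends them to infinity. *)
Lemma compact_subsequence n (K : set 'rV[R]_n) (u : nat -> 'rV[R]_n) :
  compact K -> (forall k, K (u k)) ->
  exists2 p, K p & exists2 s : nat -> nat,
    (forall k, (k <= s k)%N) & u \o s @ \oo --> p.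
Proof.
move=> cK uK.
have [|p [Kp clp]] := cK (u @ \oo) _; first by exists 0%N => // j _; exact: uK.
exists p => //.
have /choice[s sP] : forall k, exists j, (k <= j)%N /\ `|u j - p| <= k.+1%:R^-1.
  move=> k.
  have [||q [[j /= kj <-]]] :=
      clp [set u j | j in [set j | (k <= j)%N]] (ball p k.+1%:R^-1).
  - by exists k => // j /= kj; exists j.
  - by apply: nbhsx_ballx; rewrite invr_gt0.
  by rewrite -ball_normE/= => pj; exists j; rewrite distrC ltW.
exists s => [k|]; first by case: (sP k).
apply: (@cvg_dist_harmonic _ (fun=> p)); first exact: cvg_cst.
by move=> k; case: (sP k).
Qed.

Lemma continuous_dist n (a : 'rV[R]_n) :
  continuous (fun z : 'rV[R]_n => `|z - a|).
Proof.
move=> z; have h : (fun z : 'rV[R]_n => z - a) @ z --> z - a.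
  exact: cvgB (@cvg_id _ _) (@cvg_cst _ _ _ _ _).
exact: cvg_norm h.
Qed.

Lemma compact_setI_ball n (a : 'rV[R]_n) (r : R) (A : set 'rV[R]_n) :
  closed A -> compact (A `&` [set z | `|z - a| <= r]).
Proof.
move=> cA; apply: bounded_closed_compact.
  exists (r + `|a|); split; first exact: num_real.
  move=> y ry z [_ /= zr]; rewrite -(subrK a z) (le_trans (ler_normD _ _))//.
  by rewrite ltW// (le_lt_trans _ ry)// lerD2r.
apply: closedI => //.
apply: (@closed_comp _ _ (fun z : 'rV[R]_n => `|z - a|) [set y : R | y <= r]).
  by move=> z _; exact: continuous_dist.
exact: closed_le.
Qed.

(** * Regular normals and local inequalities *)

(** Dividing the bound at [d = t k *: w_ k] by [t k] leaves a right-hand side of order [t k], which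
    vanishes in the limit. *)
Lemma proximal_normal_regular n (A : set 'rV[R]_n) a v (r C : R) :
  A a -> 0 < r ->
  (forall d, `|d| < r -> A (a + d) -> dot v d <= C * dot d d) ->
  regular_normal_cone A a v.
Proof.
move=> Aa r0 vC; split=> // w [_ [t [w_ [t0 tcvg wcvg Atw]]]].
rewrite -/(dot v w).
have twcvg : (fun k => t k *: w_ k) @ \oo --> (0 : 'rV[R]_n).
  by rewrite -(scale0r w); exact: cvgZ.
have rhs : (fun k => C * (t k * dot (w_ k) (w_ k))) @ \oo --> (0 : R).
  rewrite -(mulr0 C) -(mul0r (dot w w)).
  by apply: cvgM; [exact: cvg_cst|apply: cvgM => //; exact: cvg_dot].
have lhs : (fun k => dot v (w_ k)) @ \oo --> dot v w.
  by apply: cvg_dot => //; exact: cvg_cst.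
apply: (ler_cvg_to lhs rhs).
near=> k.
have /vC : `|t k *: w_ k| < r.
  by near: k; move/cvgr0Pnorm_lt : twcvg; exact.
move=> /(_ (Atw k)); rewrite !dotZr dotZl.
by rewrite [C * (t k * _)]mulrCA ler_pM2l.
Unshelve. all: by end_near. Qed.

(** Otherwise the normalised violating increments cluster at a tangent direction [p] with
    [dot v p >= e > 0], against polarity. *)
Lemma regular_normal_little_o n (A : set 'rV[R]_n) a v (e : R) :
  regular_normal_cone A a v -> 0 < e ->
  exists2 r : R, 0 < r &
    forall x, A x -> `|x - a| <= r -> dot v (x - a) <= e * `|x - a|.
Proof.
move=> [Aa vN] e0; apply: contrapT => H.
have /choice[x xP] : forall k : nat, exists x,
    [/\ A x, `|x - a| <= k.+1%:R^-1 & e * `|x - a| < dot v (x - a)].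
  move=> k; apply: contrapT => nx; apply: H; exists k.+1%:R^-1.
    by rewrite invr_gt0.
  move=> x Ax xa; rewrite leNgt; apply/negP => lt.
  by apply: nx; exists x.
pose t k := `|x k - a|.
have t0 k : 0 < t k.
  rewrite normr_gt0; apply/eqP => xa.
  by case: (xP k); rewrite xa normr0 mulr0 dot0r ltxx.
pose w k := (t k)^-1 *: (x k - a).
have tw k : t k *: w k = x k - a by rewrite scalerA divff ?scale1r ?lt0r_neq0.
have wK k : ([set: 'rV[R]_n] `&` [set u | `|u - 0| <= 1]) (w k).
  split=> //=; rewrite subr0 normrZ normfV normr_id mulVf//.
  exact: lt0r_neq0 (t0 k).
have cK := @compact_setI_ball n 0 1 _ closedT.
have [p Kp [s ks wp]] := compact_subsequence cK wK.
have tp : tangent_cone A a p.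
  split=> //; exists (t \o s), (w \o s); split => //=.
  - have tcvg : t @ \oo --> (0 : R).
      apply: cvg0_le_harmonic => k; rewrite ger0_norm ?(ltW (t0 _))//.
      by case: (xP k).
    apply: cvg_comp tcvg => P [N _ NP]; exists N => // k /= Nk.
    by apply: NP => /=; exact: leq_trans (ks k).
  - by move=> k; rewrite tw addrC subrK; case: (xP (s k)).
have := vN _ tp; rewrite -/(dot v p) leNgt => /negP; apply.
apply: (lt_le_trans e0).
have lhs : (fun k => dot v (w (s k))) @ \oo --> dot v p.
  by apply: cvg_dot => //; exact: cvg_cst.
apply: (cvgr_to_ge lhs).
apply: nearW => k; case: (xP (s k)) => _ _.
by rewrite -/(t _) mulrC -tw dotZr ltr_pM2l// => /ltW.
Qed.

End row_vectors.

(** * Penalisation of the constraint *)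

Section penalization.
Variables (R : realType) (n m : nat) (Phi : 'rV[R]_n -> set 'rV[R]_m).

(** One tolerance bounds all three errors, so a single choice of [e] per index serves the diagonal
    argument. *)
Lemma regular_normal_approx a v (e : R) :
  closed (gph Phi) -> regular_normal_cone (zero_set Phi) a v -> 0 < e ->
  exists x y xs, [/\ `|x - a| <= e, `|y| <= e, `|xs - v| <= e
    & multiplier_image Phi x y xs].
Proof.
move=> Phi_closed vN e0; have Ma : Phi a 0 by case: vN.
have e40 : 0 < e / 4 by rewrite divr_gt0.
have [r0 r00 vlo] := regular_normal_little_o vN e40.
(* [r <= r0] keeps the little-o estimate valid on the ball; [r <= e] yields the final distance
   bounds. *)
pose r := Num.min r0 e.
have r_gt0 : 0 < r by rewrite lt_min r00.
have rr0 : r <= r0 by rewrite ge_min lexx.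
have re : r <= e by rewrite ge_min lexx orbT.
(* [c r] is large enough to beat the little-o slope [e / 4] on the sphere of
   radius [r], yet the perturbation [2 c (x - a)] of [v] is at most [e]. *)
pose c := e / 2 / r.
have c0 : 0 < c by rewrite !divr_gt0.
have c20 : 0 < 2 * c by rewrite pmulr_rgt0.
have cr : c * r = e / 2 by rewrite /c divfK ?lt0r_neq0.
pose z0 : 'rV[R]_(n + m) := row_mx a 0.
pose g (z : 'rV[R]_(n + m)) := c * dot (lsubmx (z - z0)) (lsubmx (z - z0))
            - dot v (lsubmx (z - z0)).
pose h (z : 'rV[R]_(n + m)) := dot (rsubmx (z - z0)) (rsubmx (z - z0)).
(* The filter is arbitrary because these limits serve both along subsequences and at a point, for
   continuity. *)
have cvgB0 T (F : set_system T) (FF : Filter F) (u : T -> 'rV[R]_(n + m))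
    (z : 'rV[R]_(n + m)) :
    u @ F --> z -> (fun t => u t - z0) @ F --> z - z0.
  by move=> uz; exact: cvgB uz (@cvg_cst _ _ _ _ _).
have cvg_g T (F : set_system T) (FF : Filter F) (u : T -> 'rV[R]_(n + m))
    (z : 'rV[R]_(n + m)) :
    u @ F --> z -> (fun t => g (u t)) @ F --> g z.
  move=> /cvgB0 uz; have lz := cvg_lsubmx (FF := FF) uz.
  have lin : (fun t => dot v (lsubmx (u t - z0))) @ F -->
      dot v (lsubmx (z - z0)).
    exact: cvg_dot (cvg_cst v) lz.
  exact: cvgB (cvgM (cvg_cst c) (cvg_dot lz lz)) lin.
have cvg_h T (F : set_system T) (FF : Filter F) (u : T -> 'rV[R]_(n + m))
    (z : 'rV[R]_(n + m)) :
    u @ F --> z -> (fun t => h (u t)) @ F --> h z.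
  by move=> /cvgB0 uz; have rz := cvg_rsubmx (FF := FF) uz; exact: cvg_dot.
have h_ge0 z : 0 <= h z by exact: dotvv_ge0.
pose B := gph Phi `&` [set z | `|z - z0| <= r].
have cB : compact B by exact: compact_setI_ball.
have Bz0 : B z0.
  by split; rewrite /= /gph/= ?row_mxKl ?row_mxKr// subrr normr0 ltW.
have fz0 k : g z0 + k * h z0 = 0.
  by rewrite /g /h subrr !linear0 !dot0r; lra.
(* Here the second block is 0, so the first is a point of the zero set at distance exactly [r] from
   [a]: the linear term is at most [e / 4 * r], the quadratic one at least
   [c * r ^+ 2 = e / 2 * r]. *)
have g_gt0 z : B z -> r <= `|z - z0| -> h z = 0 -> 0 < g z.
  move=> [Gz /= zr] rz hz.
  have y0 : rsubmx (z - z0) = 0.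
    apply/eqP; rewrite -normr_eq0 -sqrf_eq0 eq_le sqr_ge0 andbT -hz.
    exact: sqr_norm_le_dot.
  pose x := lsubmx z.
  have zE : z = row_mx x 0.
    rewrite -[z]hsubmxK; congr row_mx.
    by move/eqP: y0; rewrite linearB/= row_mxKr subr0 => /eqP.
  have xz : z - z0 = row_mx (x - a) 0.
    by rewrite zE /z0 opp_row_mx add_row_mx subrr.
  have xr : `|x - a| = r.
    by apply/le_anti; rewrite -(norm_row_mx0 m (x - a)) -xz zr rz.
  have Mx : zero_set Phi x by move: Gz; rewrite /gph/= zE row_mxKl row_mxKr.
  have := vlo x Mx; rewrite xr => /(_ rr0) vx.
  have := sqr_norm_le_dot (x - a); rewrite xr => cx.
  rewrite /g xz row_mxKl subr_gt0 (le_lt_trans vx)//.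
  apply: (@lt_le_trans _ _ (c * r ^+ 2)); last by rewrite ler_pM2l.
  rewrite expr2 mulrA cr ltr_pM2r//; lra.
(* A violation for every [k] would produce a limit point on the sphere with
   [h = 0] and [g <= 0]. *)
have [k kP] : exists k : nat, forall z, B z -> r <= `|z - z0| ->
    0 < g z + k.+1%:R * h z.
  apply: contrapT => nk.
  have /choice[z zP] : forall k : nat, exists z,
      [/\ B z, r <= `|z - z0| & g z + k.+1%:R * h z <= 0].
    move=> k; apply: contrapT => nz; apply: nk; exists k => z Bz rz.
    by rewrite ltNge; apply/negP => ?; apply: nz; exists z.
  have zB k : B (z k) by case: (zP k).
  have [p Bp [s ks zp]] := compact_subsequence cB zB.
  have gp : (fun k => g (z (s k))) @ \oo --> g p by exact: cvg_g.
  have hp : (fun k => h (z (s k))) @ \oo --> h p by exact: cvg_h.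
  have np : (fun k => `|z (s k) - z0|) @ \oo --> `|p - z0|.
    by apply: cvg_norm; exact: cvgB0.
  have h0 : h p = 0.
    apply/le_anti; rewrite h_ge0 andbT.
    (* This sequence bounds [h (z (s k))] from above, since [k <= s k] and [h] is nonnegative; it
       tends to 0 because [g (z (s k))] converges. *)
    have hk : (fun k => k.+1%:R^-1 * - g (z (s k))) @ \oo --> (0 : R).
      rewrite -(mul0r (- g p)); apply: cvgM; first exact: cvg_harmonic.
      exact: cvgN.
    apply: (ler_cvg_to hp hk); apply: nearW => k.
    rewrite -ler_pdivrMl ?invr_gt0// invrK.
    case: (zP (s k)) => _ _ zs.
    have : k.+1%:R * h (z (s k)) <= (s k).+1%:R * h (z (s k)).
      by rewrite ler_wpM2r// ler_nat ltnS.
    lra.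
  have gt : 0 < g p.
    apply: g_gt0 => //; apply: (cvgr_to_ge np).
    by apply: nearW => k; case: (zP (s k)).
  have : g p <= 0.
    apply: (cvgr_to_le gp); apply: nearW => k.
    case: (zP (s k)) => _ _; apply: le_trans.
    by rewrite lerDl mulr_ge0.
  by rewrite leNgt gt.
pose f (z : 'rV[R]_(n + m)) := g z + k.+1%:R * h z.
have [|z] := @EVT_min_rV _ _ f B (ex_intro _ z0 Bz0) cB.
  apply: continuous_subspaceT => z.
  have gz := cvg_g _ _ (nbhs_filter z) id z (@cvg_id _ _).
  have hz := cvg_h _ _ (nbhs_filter z) id z (@cvg_id _ _).
  exact: cvgD gz (cvgM (cvg_cst _) hz).
rewrite inE => Bz zmin.
(* [f] vanishes at [z0] and is positive on the sphere, so the minimiser lies strictly inside the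
   ball. *)
have fz : f z <= 0 by rewrite -(fz0 k.+1%:R) zmin ?inE.
have zr : `|z - z0| < r.
  by rewrite ltNge; apply/negP => /(kP _ Bz); rewrite ltNge fz.
pose px := lsubmx (z - z0); pose y := rsubmx z.
have py : rsubmx (z - z0) = y by rewrite linearB/= row_mxKr subr0.
have pxE : px = lsubmx z - a by rewrite /px linearB/= row_mxKl.
have zE : z = row_mx (lsubmx z) y by rewrite hsubmxK.
have pxr : `|px| <= r by rewrite (le_trans (norm_lsubmx_le _))// ltW.
(* The last witness is minus the gradient of [f] at [z] in the first block. *)
exists (lsubmx z), y, (v - (2 * c) *: px); split.
- by rewrite -pxE (le_trans pxr).
- by rewrite -py (le_trans (norm_rsubmx_le _))// ltW// (lt_le_trans zr).
- rewrite addrAC subrr add0r normrN normrZ [`|2 * c|]gtr0_norm//.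
  apply: (@le_trans _ _ (2 * c * r)); first by rewrite ler_pM2l.
  by rewrite -mulrA cr; lra.
(* The coderivative negates its argument, so the multiplier is plus the gradient in the second
   block. *)
exists ((2 * k.+1%:R) *: y) => //.
have rN : regular_normal_cone (gph Phi) z
    (row_mx (v - (2 * c) *: px) (- ((2 * k.+1%:R) *: y))).
  (* The radius keeps [z + d] in the ball. Minimality gives the bound
     [c * dot dx dx + k.+1%:R * dot dy dy]; adding the two missing nonnegative terms turns it into a
     multiple of [dot d d]. *)
  apply: (@proximal_normal_regular _ _ _ _ _ (r - `|z - z0|) (c + k.+1%:R)).
  - by case: Bz.
  - by rewrite subr_gt0.
  move=> d dr zd.
  have Bzd : B (z + d).
    split=> //=; rewrite addrAC (le_trans (ler_normD _ _))//.
    by move: dr; lra.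
  have zdE : z + d - z0 = z - z0 + d by rewrite addrAC.
  have := zmin (z + d); rewrite inE => /(_ Bzd); rewrite /f /g /h zdE.
  have -> : d = row_mx (lsubmx d) (rsubmx d) by rewrite hsubmxK.
  move: (lsubmx d) (rsubmx d) => dx dy.
  rewrite -[z - z0]hsubmxK -/px py add_row_mx !row_mxKl !row_mxKr.
  rewrite !dot_row_mx !(dotDl, dotDr, dotNl, dotZl) (dotC dx px) (dotC dy y).
  have := mulr_ge0 (ltW c0) (dotvv_ge0 dy).
  have := mulr_ge0 (ler0n R k.+1) (dotvv_ge0 dx).
  lra.
split; first by rewrite -zE; case: Bz.
(* Constant sequences make a regular normal a limiting one. *)
exists (fun=> z), (fun=> row_mx (v - (2 * c) *: px) (- ((2 * k.+1%:R) *: y))).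
split=> //; first by rewrite -zE; exact: cvg_cst.
- by case: Bz.
- exact: cvg_cst.
Qed.

(** Approximating [v_ k] at [a_ k] with tolerance [1 / (k + 1)] produces sequences with the same
    limits as [a_] and [v_], and second components tending to 0. *)
Lemma limiting_normal_limsup a :
  closed (gph Phi) ->
  limiting_normal_cone (zero_set Phi) a `<=` multiplier_image_limsup Phi a 0.
Proof.
move=> Phi_closed v [_ [a_ [v_ [acvg _ vcvg vN]]]].
have /choice[w wP] : forall k : nat, exists w : 'rV[R]_n * 'rV[R]_m * 'rV[R]_n,
    [/\ `|w.1.1 - a_ k| <= k.+1%:R^-1, `|w.1.2| <= k.+1%:R^-1,
        `|w.2 - v_ k| <= k.+1%:R^-1
      & multiplier_image Phi w.1.1 w.1.2 w.2].
  move=> k; have k0 : 0 < k.+1%:R^-1 :> R by rewrite invr_gt0.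
  have [x [y [xs [xa y0 xv xsM]]]] :=
    regular_normal_approx Phi_closed (vN k) k0.
  by exists (x, y, xs).
exists (fun k => (w k).1.1), (fun k => (w k).1.2), (fun k => (w k).2); split.
- by apply: (cvg_dist_harmonic acvg) => k; case: (wP k).
- by apply: cvg0_le_harmonic => k; case: (wP k).
- by apply: (cvg_dist_harmonic vcvg) => k; case: (wP k).
- by move=> k; case: (wP k).
Qed.

End penalization.

Theorem theorem3p16 (R : realType) (n m : nat)
    (Phi : 'rV[R]_n -> set 'rV[R]_m) (xbar : 'rV[R]_n)
    (Phi_closed : closed (gph Phi))
    (xbarM : zero_set Phi xbar)
    (xbar_reg : AM_regular Phi xbar) :
  limiting_normal_cone (zero_set Phi) xbar `<=` multiplier_image Phi xbar 0 /\
  multiplier_image Phi xbar 0 =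
    \bigcup_(lambda in [set: 'rV[R]_m]) coderivative Phi xbar 0 lambda.
Proof.
(* The equality is the definition of [multiplier_image], so only the inclusion remains. *)
split=> // v vN; apply: xbar_reg.
exact: (limiting_normal_limsup Phi_closed vN).
Qed.
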